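(* Let $\langle\mathcal{C},\mathbf{F},\alpha\rangle$ be an $\mathbf{IEL}^{-}$-category, with an assignment of objects of $\mathcal{C}$ to atomic types, and let $[\![\cdot]\!]$ be the induced interpretation of the modal lambda calculus $\lambda_{\mathbf{IEL}^{-}}$. Let $\Gamma\vdash M:\varphi$ and $M =_r N$. Then $[\![\Gamma\vdash M:\varphi]\!] = [\![\Gamma\vdash N:\varphi]\!]$.
   Context: The modal lambda calculus $\lambda_{\mathbf{IEL}^{-}}$. Types are generated from atomic types $p_0,p_1,\dots$ by $\varphi\to\psi$, $\varphi\times\psi$, $\bigcirc\varphi$. Terms are generated by: variables; $\lambda x.M$; $MN$; $\langle M,N\rangle$; $\pi_1 M$; $\pi_2 M$; $\mathbf{pure}\ M$; $\mathbf{let}\ \bigcirc\vec{x} = \vec{M}\ \mathbf{in}\ N$, where $\vec{x}$ is a finite (possibly empty) sequence of variables and $\vec{M}$ is a sequence of terms of the same length. A context $\Gamma$ is a finite sequence of type declarations $x_i:\varphi_i$. Typing rules: (ax) $\Gamma, x:\varphi \vdash x:\varphi$; ($\to_i$) from $\Gamma,x:\varphi\vdash M:\psi$ infer $\Gamma\vdash\lambda x.M:\varphi\to\psi$; ($\to_e$) from $\Gamma\vdash M:\varphi\to\psi$ and $\Gamma\vdash N:\varphi$ infer $\Gamma\vdash MN:\psi$; ($\times_i$) from $\Gamma\vdash M:\varphi$ and $\Gamma\vdash N:\psi$ infer $\Gamma\vdash\langle M,N\rangle:\varphi\times\psi$; ($\times_e$) from $\Gamma\vdash M:\varphi_1\times\varphi_2$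 infer $\Gamma\vdash\pi_iM:\varphi_i$, $i=1,2$; ($\bigcirc_I$) from $\Gamma\vdash M:\varphi$ infer $\Gamma\vdash\mathbf{pure}\ M:\bigcirc\varphi$; ($\mathrm{let}_\bigcirc$) from $\Gamma\vdash M_1:\bigcirc\varphi_1,\dots,\Gamma\vdash M_n:\bigcirc\varphi_n$ and $x_1:\varphi_1,\dots,x_n:\varphi_n\vdash N:\psi$ infer $\Gamma\vdash\mathbf{let}\ \bigcirc x_1,\dots,x_n = M_1,\dots,M_n\ \mathbf{in}\ N:\bigcirc\psi$. Free variables: $FV(x)=\{x\}$; $FV(\lambda x.M)=FV(M)\setminus\{x\}$; $FV(MN)=FV(\langle M,N\rangle)=FV(M)\cup FV(N)$; $FV(\pi_iM)=FV(\mathbf{pure}\ M)=FV(M)$; $FV(\mathbf{let}\ \bigcirc\vec{x}=\vec{M}\ \mathbf{in}\ N)=\bigcup_{i=1}^n FV(M_i)$, where $n$ is the length of $\vec M$. Substitution: $x[x:=N]=N$, $x[y:=N]=x$; $(MN)[x:=P]=M[x:=P]\,N[x:=P]$; $(\lambda x.M)[y:=N]=\lambda x.M[y:=N]$, $y\in FV(M)$; $\langle M,N\rangle[x:=P]=\langle M[x:=P],N[x:=P]\rangle$; $(\pi_iM)[x:=P]=\pi_i(M[x:=P])$; $(\mathbf{pure}\ M)[x:=P]=\mathbf{pure}\ (M[x:=P])$; $(\mathbf{let}\ \bigcirc\vec{x} = \vec{M}\ \mathbf{in}\ N)[y:=P] = \mathbf{let}\ \bigcirc\vec{x} = (\vec{M}[y:=P])\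 \mathbf{in}\ N$. Reduction: $M\to_r N$ if $M$ reduces to $N$ by one of the following rules: 1. $(\lambda x.M)N \to M[x:=N]$; 2. $\pi_1\langle M,N\rangle\to M$; 3. $\pi_2\langle M,N\rangle\to N$; 4. $\mathbf{let}\ \bigcirc\vec{x},y,\vec{z} = \vec{M},(\mathbf{let}\ \bigcirc\vec{w}=\vec{N}\ \mathbf{in}\ Q),\vec{P}\ \mathbf{in}\ R \;\to\; \mathbf{let}\ \bigcirc\vec{x},\vec{w},\vec{z} = \vec{M},\vec{N},\vec{P}\ \mathbf{in}\ R[y:=Q]$; 5. $\mathbf{let}\ \bigcirc\vec{x}=\mathbf{pure}\ \vec{M}\ \mathbf{in}\ N \;\to\; \mathbf{pure}\ N[\vec{x}:=\vec{M}]$ (where $\mathbf{pure}\ \vec M$ is the sequence $\mathbf{pure}\ M_1,\dots,\mathbf{pure}\ M_n$); 6. $\mathbf{let}\ \bigcirc\underline{\ }=\underline{\ }\ \mathbf{in}\ M\;\to\;\mathbf{pure}\ M$, where $\underline{\ }$ is the empty sequence. The multistep reduction $\twoheadrightarrow_r$ is the reflexive transitive closure of $\to_r$, and $=_r$ is the symmetric closure of $\twoheadrightarrow_r$. Categories. Write $\mathbf{1}$ for the terminal object. A monoidal endofunctor on a cartesian closed category $\mathcal{C}$ is a functor $\mathbf{F}:\mathcal{C}\to\mathcal{C}$ with a natural transformation $m$ with components $m_{A,B}:\mathbf{F}A\times\mathbf{F}B\to\mathbf{F}(A\times B)$ and a morphism $u:\mathbf{1}\to\mathbf{F}\mathbf{1}$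 satisfying the usual associativity and unit coherence diagrams. An $\mathbf{IEL}^{-}$-category is $\langle\mathcal{C},\mathbf{F},\alpha\rangle$ with $\mathcal{C}$ cartesian closed, $\mathbf{F}$ a monoidal endofunctor on $\mathcal{C}$ and $\alpha:\operatorname{Id}_{\mathcal{C}}\to\mathbf{F}$ a natural transformation such that $u=\alpha_{\mathbf{1}}$ and $m_{A,B}\circ(\alpha_A\times\alpha_B)=\alpha_{A\times B}$. Interpretation. $[\![p_i]\!]$ is the assigned object, $[\![\varphi\to\psi]\!]=[\![\psi]\!]^{[\![\varphi]\!]}$, $[\![\varphi\times\psi]\!]=[\![\varphi]\!]\times[\![\psi]\!]$, $[\![\bigcirc\varphi]\!]=\mathbf{F}[\![\varphi]\!]$; the empty context is interpreted by $\mathbf{1}$ and $[\![\Gamma,x:\varphi]\!]=[\![\Gamma]\!]\times[\![\varphi]\!]$. A typing assignment $\Gamma\vdash M:\varphi$ is interpreted as an arrow $[\![\Gamma\vdash M:\varphi]\!]=[\![M]\!]:[\![\Gamma]\!]\to[\![\varphi]\!]$, following the typing rules: (ax) by the projection $\pi_2:[\![\Gamma]\!]\times[\![\varphi]\!]\to[\![\varphi]\!]$; $\lambda x.M$ by the currying $\Lambda([\![M]\!])$; $MN$ by $\epsilon\circ\langle[\![M]\!],[\![N]\!]\rangle$, with $\epsilon$ the evaluation arrow; $\langle M,N\rangle$ by $\langle[\![M]\!],[\![N]\!]\rangle$; $\pi_iM$ by $\pi_i\circ[\![M]\!]$; $\mathbf{pure}\ M$ (for $M:\varphi$) by $\alpha_{[\![\varphi]\!]}\circ[\![M]\!]$;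 and $\mathbf{let}\ \bigcirc\vec{x}=\vec{M}\ \mathbf{in}\ N$ by $\mathbf{F}([\![N]\!])\circ m_{[\![\varphi_1]\!],\dots,[\![\varphi_n]\!]}\circ\langle[\![M_1]\!],\dots,[\![M_n]\!]\rangle$, where $m_{A_1,\dots,A_n}:\prod_i\mathbf{F}A_i\to\mathbf{F}(\prod_iA_i)$ is the $n$-ary version of $m$ ($u$ in the case $n=0$). *)

(* Defs.v *)
From Stdlib Require Export Relation_Operators.
From mathcomp Require Export all_boot.

Set Implicit Arguments.
Unset Strict Implicit.
Unset Printing Implicit Defensive.

(* Terms are taken up to alpha-equivalence and are represented with de Bruijn
   indices.  All finite sequences (contexts, the variables and the terms bound
   by a let) are stored with their LAST item at the head of the list, so that
   [phi :: Gamma] is "Gamma, x : phi", index 0 is the last declared variable,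
   and item i of the list of terms of a let is bound to index i of its body. *)

Inductive ty : Type :=
| Atom of nat
| Arr of ty & ty
| Prod of ty & ty
| Box of ty.

Inductive term : Type :=
| Var of nat
| Lam of term
| App of term & term
| Pair of term & term
| Fst of term
| Snd of term
| Pure of term
| Let of seq term & term.

(* The body of a let lives in the scope of the variables bound by that let and
   of nothing else (FV (let x = Ms in N) is the union of the FV (Ms_i)); hence
   renaming and substitution do not enter it. *)
Fixpoint ren (r : nat -> nat) (M : term) : term :=
  match M with
  | Var i => Var (r i)
  | Lam M => Lam (ren (fun i => if i is j.+1 then (r j).+1 else 0) M)
  | App M N => App (ren r M) (ren r N)
  | Pair M N => Pair (ren r M) (ren r N)
  | Fst M => Fst (ren r M)
  | Snd M => Snd (ren r M)
  | Pure M => Pure (ren r M)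
  | Let Ms N => Let (map (ren r) Ms) N
  end.

Fixpoint subst (s : nat -> term) (M : term) : term :=
  match M with
  | Var i => s i
  | Lam M => Lam (subst (fun i => if i is j.+1 then ren S (s j) else Var 0) M)
  | App M N => App (subst s M) (subst s N)
  | Pair M N => Pair (subst s M) (subst s N)
  | Fst M => Fst (subst s M)
  | Snd M => Snd (subst s M)
  | Pure M => Pure (subst s M)
  | Let Ms N => Let (map (subst s) Ms) N
  end.

(* N[xs := Ms], the xs being the variables 0, ..., size Ms - 1 of N. *)
Definition subst_seq (Ms : seq term) (N : term) : term :=
  subst (fun i => nth (Var (i - size Ms)) Ms i) N.

(* R[y := Q], where y is the variable k of R and where the n variables of the
   scope of Q take the place of y in the scope of R. *)
Definition subst_at (k n : nat) (Q R : term) : term :=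
  subst (fun i => if i < k then Var i
                  else if i == k then ren (addn k) Q
                  else Var (i.-1 + n)) R.

Inductive step : term -> term -> Prop :=
| step_beta M N : step (App (Lam M) N) (subst_seq [:: N] M)
| step_fst M N : step (Fst (Pair M N)) M
| step_snd M N : step (Snd (Pair M N)) N
| step_let_let Ms Ns Ps Q R :
    step (Let (Ps ++ Let Ns Q :: Ms) R)
         (Let (Ps ++ Ns ++ Ms) (subst_at (size Ps) (size Ns) Q R))
| step_let_pure Ms N : step (Let (map Pure Ms) N) (Pure (subst_seq Ms N))
| step_let_nil M : step (Let [::] M) (Pure M)
| step_Lam M M' : step M M' -> step (Lam M) (Lam M')
| step_App1 M M' N : step M M' -> step (App M N) (App M' N)
| step_App2 M N N' : step N N' -> step (App M N) (App M N')
| step_Pair1 M M' N : step M M' -> step (Pair M N) (Pair M' N)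
| step_Pair2 M N N' : step N N' -> step (Pair M N) (Pair M N')
| step_Fst M M' : step M M' -> step (Fst M) (Fst M')
| step_Snd M M' : step M M' -> step (Snd M) (Snd M')
| step_Pure M M' : step M M' -> step (Pure M) (Pure M')
| step_Let1 Ps M M' Ms N : step M M' ->
    step (Let (Ps ++ M :: Ms) N) (Let (Ps ++ M' :: Ms) N)
| step_Let2 Ms N N' : step N N' -> step (Let Ms N) (Let Ms N').

Definition multistep : term -> term -> Prop := clos_refl_trans term step.

Definition conv (M N : term) : Prop := multistep M N \/ multistep N M.

(* Derivations are in Type because the interpretation is by recursion on them:
   abstractions carry no type annotation, so that the conclusion of a
   derivation does not determine the derivation. *)

Inductive has_var : seq ty -> nat -> ty -> Type :=
| var_last Γ φ : has_var (φ :: Γ) 0 φ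
| var_skip Γ ψ i φ : has_var Γ i φ -> has_var (ψ :: Γ) i.+1 φ.

(* [has_box_types Γ Ms φs]: each Ms_i has type Box φs_i, and the two sequences
   have the same length. *)
Inductive has_type : seq ty -> term -> ty -> Type :=
| ty_Var Γ i φ : has_var Γ i φ -> has_type Γ (Var i) φ
| ty_Lam Γ M φ ψ : has_type (φ :: Γ) M ψ -> has_type Γ (Lam M) (Arr φ ψ)
| ty_App Γ M N φ ψ :
    has_type Γ M (Arr φ ψ) -> has_type Γ N φ -> has_type Γ (App M N) ψ
| ty_Pair Γ M N φ ψ :
    has_type Γ M φ -> has_type Γ N ψ -> has_type Γ (Pair M N) (Prod φ ψ)
| ty_Fst Γ M φ ψ : has_type Γ M (Prod φ ψ) -> has_type Γ (Fst M) φ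
| ty_Snd Γ M φ ψ : has_type Γ M (Prod φ ψ) -> has_type Γ (Snd M) ψ
| ty_Pure Γ M φ : has_type Γ M φ -> has_type Γ (Pure M) (Box φ)
| ty_Let Γ Ms φs N ψ :
    has_box_types Γ Ms φs -> has_type φs N ψ -> has_type Γ (Let Ms N) (Box ψ)
with has_box_types : seq ty -> seq term -> seq ty -> Type :=
| box_nil Γ : has_box_types Γ [::] [::]
| box_cons Γ M Ms φ φs :
    has_type Γ M (Box φ) -> has_box_types Γ Ms φs ->
    has_box_types Γ (M :: Ms) (φ :: φs).

Record category : Type := Category {
  obj :> Type;
  hom : obj -> obj -> Type;
  idm : forall A, hom A A;
  comp : forall A B C, hom B C -> hom A B -> hom A C;
  comp_idl : forall A B (f : hom A B), comp (idm B) f = f;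
  comp_idr : forall A B (f : hom A B), comp f (idm A) = f;
  compA : forall A B C D (h : hom C D) (g : hom B C) (f : hom A B),
    comp h (comp g f) = comp (comp h g) f }.

Arguments hom {c} A B.
Arguments idm {c} A.
Arguments comp {c A B C} g f.

Notation "g '\oc' f" := (comp g f) (at level 40, left associativity).

Record functor (C D : category) : Type := Functor {
  fobj :> C -> D;
  fmap : forall A B : C, hom A B -> hom (fobj A) (fobj B);
  fmap_id : forall A : C, fmap (idm A) = idm (fobj A);
  fmap_comp : forall (A B E : C) (g : hom B E) (f : hom A B),
    fmap (g \oc f) = fmap g \oc fmap f }.

Arguments fmap {C D} f0 {A B} f.

Definition id_functor (C : category) : functor C C :=
  @Functor C C (fun A => A) (fun A B f => f)
    (fun A => erefl) (fun A B E g f => erefl).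

Record nat_trans (C D : category) (F G : functor C D) : Type := NatTrans {
  component :> forall A : C, hom (F A) (G A);
  naturality : forall (A B : C) (f : hom A B),
    component B \oc fmap F f = fmap G f \oc component A }.

(* Terminal object, binary products and exponentials are chosen;
   [expo A B] is B^A. *)
Record ccc : Type := CCC {
  ccc_cat :> category;
  one : ccc_cat;
  bang : forall A : ccc_cat, hom A one;
  bang_uniq : forall (A : ccc_cat) (f : hom A one), f = bang A;
  cprod : ccc_cat -> ccc_cat -> ccc_cat;
  pr1 : forall A B, hom (cprod A B) A;
  pr2 : forall A B, hom (cprod A B) B;
  pairing : forall X A B, hom X A -> hom X B -> hom X (cprod A B);
  pr1_pairing : forall X A B (f : hom X A) (g : hom X B),
    pr1 A B \oc pairing f g = f;
  pr2_pairing : forall X A B (f : hom X A) (g : hom X B),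
    pr2 A B \oc pairing f g = g;
  pairing_uniq : forall X A B (h : hom X (cprod A B)),
    h = pairing (pr1 A B \oc h) (pr2 A B \oc h);
  expo : ccc_cat -> ccc_cat -> ccc_cat;
  ev : forall A B, hom (cprod (expo A B) A) B;
  curry : forall X A B, hom (cprod X A) B -> hom X (expo A B);
  ev_curry : forall X A B (f : hom (cprod X A) B),
    ev A B \oc pairing (curry f \oc pr1 X A) (pr2 X A) = f;
  curry_uniq : forall X A B (h : hom X (expo A B)),
    h = curry (ev A B \oc pairing (h \oc pr1 X A) (pr2 X A)) }.

Arguments one {c}.
Arguments bang {c} A.
Arguments cprod {c} _ _.
Arguments pr1 {c A B}.
Arguments pr2 {c A B}.
Arguments pairing {c X A B} f g.
Arguments expo {c} _ _.
Arguments ev {c A B}.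
Arguments curry {c X A B} f.

Definition prod_map (C : ccc) (A A' B B' : C) (f : hom A A') (g : hom B B') :
    hom (cprod A B) (cprod A' B') :=
  pairing (f \oc pr1) (g \oc pr2).

Definition prod_assoc (C : ccc) (A B D : C) :
    hom (cprod (cprod A B) D) (cprod A (cprod B D)) :=
  pairing (pr1 \oc pr1) (pairing (pr2 \oc pr1) pr2).

Record monoidal_endofunctor (C : ccc) : Type := MonoidalEndofunctor {
  mon_functor :> functor C C;
  mon_mul : forall A B : C,
    hom (cprod (mon_functor A) (mon_functor B)) (mon_functor (cprod A B));
  mon_unit : hom one (mon_functor one);
  mon_mul_nat : forall (A A' B B' : C) (f : hom A A') (g : hom B B'),
    mon_mul A' B' \oc prod_map (fmap mon_functor f) (fmap mon_functor g)
    = fmap mon_functor (prod_map f g) \oc mon_mul A B;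
  mon_assoc : forall A B D : C,
    fmap mon_functor (prod_assoc A B D)
      \oc (mon_mul (cprod A B) D \oc prod_map (mon_mul A B) (idm _))
    = mon_mul A (cprod B D) \oc prod_map (idm _) (mon_mul B D)
      \oc prod_assoc (mon_functor A) (mon_functor B) (mon_functor D);
  mon_unitl : forall A : C,
    fmap mon_functor pr2 \oc mon_mul one A \oc prod_map mon_unit (idm _)
    = pr2;
  mon_unitr : forall A : C,
    fmap mon_functor pr1 \oc mon_mul A one \oc prod_map (idm _) mon_unit
    = pr1 }.

Arguments mon_mul {C} m A B.
Arguments mon_unit {C} m.

Record iel_category : Type := IELCategory {
  iel_ccc :> ccc;
  iel_F : monoidal_endofunctor iel_ccc;
  iel_alpha : nat_trans (id_functor iel_ccc) iel_F;
  iel_unit : mon_unit iel_F = iel_alpha one;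
  iel_mul : forall A B : iel_ccc,
    mon_mul iel_F A B \oc prod_map (iel_alpha A) (iel_alpha B)
    = iel_alpha (cprod A B) }.

Arguments iel_F {i}.
Arguments iel_alpha {i}.

Section Interpretation.

Variables (C : iel_category) (p : nat -> C).

Fixpoint interp_ty (φ : ty) : C :=
  match φ with
  | Atom i => p i
  | Arr φ ψ => expo (interp_ty φ) (interp_ty ψ)
  | Prod φ ψ => cprod (interp_ty φ) (interp_ty ψ)
  | Box φ => iel_F (interp_ty φ)
  end.

Fixpoint interp_ctx (Γ : seq ty) : C :=
  if Γ is φ :: Γ' then cprod (interp_ctx Γ') (interp_ty φ) else one.

(* The n-ary version of m. *)
Fixpoint mon_mul_seq (φs : seq ty) :
    hom (interp_ctx (map Box φs)) (iel_F (interp_ctx φs)) :=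
  match φs with
  | [::] => mon_unit iel_F
  | φ :: φs' =>
      mon_mul iel_F (interp_ctx φs') (interp_ty φ)
        \oc prod_map (mon_mul_seq φs') (idm _)
  end.

Fixpoint interp_var Γ i φ (D : has_var Γ i φ) :
    hom (interp_ctx Γ) (interp_ty φ) :=
  match D with
  | var_last _ _ => pr2
  | var_skip _ _ _ _ D => interp_var D \oc pr1
  end.

Fixpoint interp Γ M φ (D : has_type Γ M φ) :
    hom (interp_ctx Γ) (interp_ty φ) :=
  match D with
  | ty_Var _ _ _ D => interp_var D
  | ty_Lam _ _ _ _ D => curry (interp D)
  | ty_App _ _ _ _ _ D E => ev \oc pairing (interp D) (interp E)
  | ty_Pair _ _ _ _ _ D E => pairing (interp D) (interp E)
  | ty_Fst _ _ _ _ D => pr1 \oc interp D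
  | ty_Snd _ _ _ _ D => pr2 \oc interp D
  | ty_Pure _ _ φ D => iel_alpha (interp_ty φ) \oc interp D
  | ty_Let _ _ φs _ _ Ds E =>
      fmap iel_F (interp E) \oc mon_mul_seq φs \oc interp_seq Ds
  end
with interp_seq Γ Ms φs (Ds : has_box_types Γ Ms φs) :
    hom (interp_ctx Γ) (interp_ctx (map Box φs)) :=
  match Ds with
  | box_nil _ => bang _
  | box_cons _ _ _ _ _ D Ds => pairing (interp_seq Ds) (interp D)
  end.

End Interpretation.

(* Main.v *)
(* The interpretation is defined on derivations, and abstractions carry no type
   annotation, so M =_r M already requires coherence: all derivations of the
   same judgement have the same interpretation.  Coherence is obtained by
   normalization: a Kripke logical relation between untyped terms and arrows
   shows that the interpretation of any derivation is read off from a
   type-directed normal form of the term, and the context, the type and the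
   untyped term leave no choice in that reading.  The theorem then follows from
   subject reduction: a derivation of M gives a derivation with the same
   interpretation for each reduct of M, to be compared with the given one. *)
Require Import Defs.
From Stdlib Require Eqdep_dec.

Set Implicit Arguments.
Unset Strict Implicit.
Unset Printing Implicit Defensive.

(** * Renamings and substitutions *)

Definition up_ren (r : nat -> nat) (i : nat) : nat :=
  if i is j.+1 then (r j).+1 else 0.

Definition up_subst (s : nat -> term) (i : nat) : term :=
  if i is j.+1 then ren S (s j) else Var 0.

Fixpoint all_terms (P : term -> Prop) (Ms : seq term) : Prop :=
  if Ms is M :: Ms' then P M /\ all_terms P Ms' else True.

Section TermInduction.

Variable P : term -> Prop.
Hypotheses (HVar : forall i, P (Var i))
  (HLam : forall M, P M -> P (Lam M))
  (HApp : forall M N, P M -> P N -> P (App M N))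
  (HPair : forall M N, P M -> P N -> P (Pair M N))
  (HFst : forall M, P M -> P (Fst M))
  (HSnd : forall M, P M -> P (Snd M))
  (HPure : forall M, P M -> P (Pure M))
  (HLet : forall Ms N, all_terms P Ms -> P (Let Ms N)).

(** The generated principle gives no hypothesis for the terms listed in a [Let], hence the inner
    [fix]. The body of the [Let] gets no hypothesis here either, since renaming and substitution
    leave it unchanged. *)
Fixpoint term_nested_ind (M : term) : P M :=
  match M with
  | Var i => HVar i
  | Lam M => HLam (term_nested_ind M)
  | App M N => HApp (term_nested_ind M) (term_nested_ind N)
  | Pair M N => HPair (term_nested_ind M) (term_nested_ind N)
  | Fst M => HFst (term_nested_ind M)
  | Snd M => HSnd (term_nested_ind M)
  | Pure M => HPure (term_nested_ind M)
  | Let Ms N => HLet N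
      ((fix go Ms : all_terms P Ms :=
          match Ms with
          | [::] => I
          | M :: Ms' => conj (term_nested_ind M) (go Ms')
          end) Ms)
  end.

End TermInduction.

Lemma all_terms_map (P : term -> Prop) (f g : term -> term) Ms :
  all_terms P Ms -> (forall M, P M -> f M = g M) -> map f Ms = map g Ms.
Proof.
move=> H fg; elim: Ms H => //= M Ms IH [HM HMs].
by rewrite (fg _ HM) (IH HMs).
Qed.

Lemma ren_ext M r r' : r =1 r' -> ren r M = ren r' M.
Proof.
elim/term_nested_ind: M r r' =>
  [i|M IH|M N IHM IHN|M N IHM IHN|M IH|M IH|M IH|Ms N IH] r r' rr' /=;
  try by rewrite ?rr' ?(IH _ _ rr') ?(IHM _ _ rr') ?(IHN _ _ rr').
- by congr Lam; apply: IH => -[|i] //=; rewrite rr'.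
- by congr Let; apply: all_terms_map IH _ => M; apply.
Qed.

Lemma subst_ext M s s' : s =1 s' -> subst s M = subst s' M.
Proof.
elim/term_nested_ind: M s s' =>
  [i|M IH|M N IHM IHN|M N IHM IHN|M IH|M IH|M IH|Ms N IH] s s' ss' /=;
  try by rewrite ?ss' ?(IH _ _ ss') ?(IHM _ _ ss') ?(IHN _ _ ss').
- by congr Lam; apply: IH => -[|i] //=; rewrite ss'.
- by congr Let; apply: all_terms_map IH _ => M; apply.
Qed.

Lemma ren_id M r : r =1 id -> ren r M = M.
Proof.
elim/term_nested_ind: M r =>
  [i|M IH|M N IHM IHN|M N IHM IHN|M IH|M IH|M IH|Ms N IH] r r1 /=;
  try by rewrite ?r1 ?(IH _ r1) ?(IHM _ r1) ?(IHN _ r1).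
- by rewrite IH // => -[|i] //=; rewrite r1.
- by rewrite (all_terms_map IH (g := id)) ?map_id // => M; apply.
Qed.

Lemma subst_Var M s : s =1 Var -> subst s M = M.
Proof.
elim/term_nested_ind: M s =>
  [i|M IH|M N IHM IHN|M N IHM IHN|M IH|M IH|M IH|Ms N IH] s s1 /=;
  try by rewrite ?s1 ?(IH _ s1) ?(IHM _ s1) ?(IHN _ s1).
- by rewrite IH // => -[|i] //=; rewrite s1.
- by rewrite (all_terms_map IH (g := id)) ?map_id // => M; apply.
Qed.

Lemma subst_ren M s r : subst s (ren r M) = subst (s \o r) M.
Proof.
elim/term_nested_ind: M s r =>
  [i|M IH|M N IHM IHN|M N IHM IHN|M IH|M IH|M IH|Ms N IH] s r //=;
  try by rewrite ?IH ?IHM ?IHN.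
- by rewrite IH; congr Lam; apply: subst_ext => -[|i].
- by rewrite -map_comp; congr Let; apply: all_terms_map IH _ => M /= ->.
Qed.

Lemma ren_ren M r r' : ren r (ren r' M) = ren (r \o r') M.
Proof.
elim/term_nested_ind: M r r' =>
  [i|M IH|M N IHM IHN|M N IHM IHN|M IH|M IH|M IH|Ms N IH] r r' //=;
  try by rewrite ?IH ?IHM ?IHN.
- by rewrite IH; congr Lam; apply: ren_ext => -[|i].
- by rewrite -map_comp; congr Let; apply: all_terms_map IH _ => M /= ->.
Qed.

Lemma ren_subst M r s : ren r (subst s M) = subst (ren r \o s) M.
Proof.
elim/term_nested_ind: M r s =>
  [i|M IH|M N IHM IHN|M N IHM IHN|M IH|M IH|M IH|Ms N IH] r s //=;
  try by rewrite ?IH ?IHM ?IHN.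
- by rewrite IH; congr Lam; apply: subst_ext => -[|i] //=; rewrite !ren_ren.
- by rewrite -map_comp; congr Let; apply: all_terms_map IH _ => M /= ->.
Qed.

Lemma subst_subst M s t : subst s (subst t M) = subst (subst s \o t) M.
Proof.
elim/term_nested_ind: M s t =>
  [i|M IH|M N IHM IHN|M N IHM IHN|M IH|M IH|M IH|Ms N IH] s t //=;
  try by rewrite ?IH ?IHM ?IHN.
- rewrite IH; congr Lam; apply: subst_ext => -[|i] //=.
  by rewrite subst_ren ren_subst.
- by rewrite -map_comp; congr Let; apply: all_terms_map IH _ => M /= ->.
Qed.

Definition scons (N : term) (s : nat -> term) (i : nat) : term :=
  if i is j.+1 then s j else N.

Lemma subst_seq1 N M : subst_seq [:: N] M = subst (scons N Var) M.
Proof. by apply: subst_ext => -[|i] //=; rewrite subn1 nth_nil. Qed.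

Lemma subst_scons_up M N s :
  subst (scons N Var) (subst (up_subst s) M) = subst (scons N s) M.
Proof.
rewrite subst_subst; apply: subst_ext => -[|i] //=.
by rewrite subst_ren subst_Var.
Qed.

Lemma ren_subst_seq1 r N M :
  ren r (subst_seq [:: N] M) = subst_seq [:: ren r N] (ren (up_ren r) M).
Proof.
rewrite !subst_seq1 ren_subst subst_ren; apply: subst_ext => -[|i] //.
Qed.

(** * Weak head evaluation *)

(** There is no rule at a [Let], not even a congruence: lets are evaluated by [down], which also
    breaks up the stuck ones. *)
Inductive wh : term -> term -> Prop :=
| wh_beta M N : wh (App (Lam M) N) (subst_seq [:: N] M)
| wh_Fst_Pair M N : wh (Fst (Pair M N)) M
| wh_Snd_Pair M N : wh (Snd (Pair M N)) N
| wh_App M M' N : wh M M' -> wh (App M N) (App M' N)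
| wh_Fst M M' : wh M M' -> wh (Fst M) (Fst M')
| wh_Snd M M' : wh M M' -> wh (Snd M) (Snd M').

Fixpoint neutral (M : term) : bool :=
  match M with
  | Var _ => true
  | App M _ | Fst M | Snd M => neutral M
  | _ => false
  end.

Lemma neutral_wh M M' : wh M M' -> ~~ neutral M.
Proof. by elim. Qed.

Lemma wh_det M N N' : wh M N -> wh M N' -> N = N'.
Proof.
move=> MN; elim: MN N' =>
  {M N} [M N|M N|M N|M M' N MM' IH|M M' MM' IH|M M' MM' IH] N' H;
  inversion H as [| | |? ? ? H'|? ? H'|? ? H']; subst;
  by [|inversion H'|inversion MM'|rewrite (IH _ H')].
Qed.

Lemma wh_ren r M N : wh M N -> wh (ren r M) (ren r N).
Proof. by elim=> *; rewrite ?ren_subst_seq1; constructor. Qed.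

Lemma neutral_ren r M : neutral (ren r M) = neutral M.
Proof. by elim: M. Qed.

(* [down n M Ks N]: in a context of length n, the term M of modal type
   evaluates to [Let Ks N], where each item of Ks is neutral or of the form
   [Pure (Var i)].  In [let x = pure M in N] the type of x is not determined by
   the term, and in general M cannot be moved past the other items of the let
   (the two strengths that alpha and m induce on F may differ), so [Pure M] is
   turned in place into the let that binds the whole context to itself.
   At an atomic type, [down n M [:: K] (Var 0)] says that M weak head reduces to
   the neutral term K. *)
Inductive down (n : nat) : term -> seq term -> term -> Prop :=
| down_wh M M' Ks N : wh M M' -> down n M' Ks N -> down n M Ks N
| down_neutral K : neutral K -> down n K [:: K] (Var 0)
| down_Pure M : down n (Pure M) [seq Pure (Var i) | i <- iota 0 n] M
| down_Let Ms N Ks Ns : downs n Ms Ks Ns ->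
    down n (Let Ms N) Ks (subst (fun i => nth (Var i) Ns i) N)
with downs (n : nat) : seq term -> seq term -> seq term -> Prop :=
| downs_nil : downs n [::] [::] [::]
| downs_cons M Ms Ks Ks' N Ns : down n M Ks N -> downs n Ms Ks' Ns ->
    downs n (M :: Ms) (Ks ++ Ks') (N :: map (ren (addn (size Ks))) Ns).

Scheme down_mut := Minimality for down Sort Prop
with downs_mut := Minimality for downs Sort Prop.

(** At most one rule of [down] applies to a given term: a neutral term has no weak head reduct, and
    neither has a [Pure] or a [Let]. Within [down_wh], [wh] itself is deterministic. *)
Lemma down_det n M Ks N Ks' N' :
  down n M Ks N -> down n M Ks' N' -> Ks = Ks' /\ N = N'.
Proof.
move=> H; move: Ks' N'.
apply: (down_mut (P := fun M Ks N => forall Ks' N', down n M Ks' N' ->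
    Ks = Ks' /\ N = N') (P0 := fun Ms Ks Ns => forall Ks' Ns',
    downs n Ms Ks' Ns' -> Ks = Ks' /\ Ns = Ns') _ _ _ _ _ _ H) =>
  {M Ks N H} [M M' Ks N MM' _ IH|K nK|M|Ms N Ks Ns _ IH||
    M Ms Ks Ks' N Ns _ IH _ IHs] Ls N' H.
- inversion H; subst.
  + by apply: IH; rewrite (wh_det MM' H0).
  + by case/negP: (neutral_wh MM').
  + by inversion MM'.
  + by inversion MM'.
- inversion H; subst => //.
  by case/negP: (neutral_wh H0).
- by inversion H; subst => //; inversion H0.
- inversion H as [? ? ? ? H'| | |? ? ? ? H']; subst => //.
    by inversion H'.
  by case: (IH _ _ H') => _ ->; case: (IH _ _ H') => ->.
- by inversion H.
- inversion H as [|? ? ? ? ? ? H1 H2]; subst.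
  by case: (IH _ _ H1) (IHs _ _ H2) => -> -> [-> ->].
Qed.

(** * Cartesian closed categories and lax monoidal functors *)

Section CCC.

Variable C : ccc.
Implicit Types X Y A B : C.

Lemma pairing_ext X A B (f g : hom X (cprod A B)) :
  pr1 \oc f = pr1 \oc g -> pr2 \oc f = pr2 \oc g -> f = g.
Proof. by move=> e1 e2; rewrite (pairing_uniq f) e1 e2 -pairing_uniq. Qed.

Lemma pairing_comp X Y A B (f : hom X A) (g : hom X B) (h : hom Y X) :
  pairing f g \oc h = pairing (f \oc h) (g \oc h).
Proof.
by apply: pairing_ext; rewrite ?pr1_pairing ?pr2_pairing compA
  ?pr1_pairing ?pr2_pairing.
Qed.

Lemma prod_map_pairing X A A' B B' (f : hom A A') (g : hom B B')
    (a : hom X A) (b : hom X B) :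
  prod_map f g \oc pairing a b = pairing (f \oc a) (g \oc b).
Proof. by rewrite pairing_comp -!compA pr1_pairing pr2_pairing. Qed.

Lemma bang_eq X (f g : hom X one) : f = g.
Proof. by rewrite (bang_uniq f) (bang_uniq g). Qed.

Lemma curry_ext X A B (f g : hom X (expo A B)) :
  ev \oc pairing (f \oc pr1) pr2 = ev \oc pairing (g \oc pr1) pr2 -> f = g.
Proof. by move=> e; rewrite (curry_uniq f) e -curry_uniq. Qed.

Lemma ev_curry_pairing X Y A B (f : hom (cprod X A) B) (h : hom Y X)
    (g : hom Y A) :
  ev \oc pairing (curry f \oc h) g = f \oc pairing h g.
Proof.
by rewrite -{2}(ev_curry f) -compA pairing_comp -compA pr1_pairing pr2_pairing.
Qed.

Lemma curry_comp X Y A B (f : hom (cprod X A) B) (h : hom Y X) :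
  curry f \oc h = curry (f \oc pairing (h \oc pr1) pr2).
Proof. by apply: curry_ext; rewrite ev_curry -compA ev_curry_pairing. Qed.

End CCC.

Section Monoidal.

Variables (C : ccc) (F : monoidal_endofunctor C).
Implicit Types X A B : C.

(** Here and below the diagrams for m are restated for arrows out of a common object X, the form in
    which the items of a let occur. *)
Lemma mul_natural X A A' B B' (f : hom A A') (g : hom B B')
    (a : hom X (F A)) (b : hom X (F B)) :
  mon_mul F A' B' \oc pairing (fmap F f \oc a) (fmap F g \oc b) =
  fmap F (prod_map f g) \oc (mon_mul F A B \oc pairing a b).
Proof. by rewrite compA -mon_mul_nat -compA prod_map_pairing. Qed.

Lemma mul_natural_l X A A' B (f : hom A A') (a : hom X (F A))
    (b : hom X (F B)) :
  mon_mul F A' B \oc pairing (fmap F f \oc a) b =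
  fmap F (prod_map f (idm B)) \oc (mon_mul F A B \oc pairing a b).
Proof. by rewrite -mul_natural fmap_id comp_idl. Qed.

Lemma mul_natural_r X A B B' (g : hom B B') (a : hom X (F A))
    (b : hom X (F B)) :
  mon_mul F A B' \oc pairing a (fmap F g \oc b) =
  fmap F (prod_map (idm A) g) \oc (mon_mul F A B \oc pairing a b).
Proof. by rewrite -mul_natural fmap_id comp_idl. Qed.

Lemma mul_assoc X A B D (a : hom X (F A)) (b : hom X (F B))
    (d : hom X (F D)) :
  fmap F (prod_assoc A B D)
    \oc (mon_mul F _ D \oc pairing (mon_mul F A B \oc pairing a b) d) =
  mon_mul F A _ \oc pairing a (mon_mul F B D \oc pairing b d).
Proof.
have := congr1 (fun h => h \oc pairing (pairing a b) d) (mon_assoc F A B D).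
rewrite -!compA prod_map_pairing comp_idl => ->; congr (_ \oc _).
rewrite /prod_assoc !(pairing_comp, =^~ compA) !(pr1_pairing, pr2_pairing).
by rewrite comp_idl.
Qed.

Lemma mul_unitl X A (a : hom X (F A)) :
  fmap F pr2 \oc (mon_mul F one A \oc pairing (mon_unit F \oc bang X) a) = a.
Proof.
have := congr1 (fun h => h \oc pairing (bang X) a) (mon_unitl F A).
by rewrite -!compA prod_map_pairing comp_idl pr2_pairing.
Qed.

(** The unit diagram has [pr1] on the other side; it is moved across because [pr1] from A × 1 to A
    is invertible, with inverse [pairing (idm A) (bang A)]. *)
Lemma mul_unitr X A (a : hom X (F A)) :
  mon_mul F A one \oc pairing a (mon_unit F \oc bang X) =
  fmap F (pairing (idm A) (bang A)) \oc a.
Proof.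
have := congr1 (fun h => h \oc pairing a (bang X)) (mon_unitr F A).
rewrite -!compA prod_map_pairing comp_idl pr1_pairing => {2}<-.
rewrite compA -fmap_comp; set e := pairing _ _ \oc _.
suff ->: e = idm _ by rewrite fmap_id comp_idl.
apply: pairing_ext; rewrite compA ?pr1_pairing ?comp_idl ?comp_idr //.
exact: bang_eq.
Qed.

End Monoidal.

Section IEL.

Variable C : iel_category.
Implicit Types X A B : C.

Lemma alpha_natural X A B (g : hom A B) (f : hom X A) :
  fmap iel_F g \oc (iel_alpha A \oc f) = iel_alpha B \oc (g \oc f).
Proof. by rewrite !compA; congr (_ \oc _); rewrite -(naturality iel_alpha g). Qed.

Lemma mul_alpha X A B (a : hom X A) (b : hom X B) :
  mon_mul iel_F A B \oc pairing (iel_alpha A \oc a) (iel_alpha B \oc b) =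
  iel_alpha (cprod A B) \oc pairing a b.
Proof. by rewrite -iel_mul -compA prod_map_pairing. Qed.

End IEL.

(** * Contexts and tuples *)

Lemma has_var_nil i a : has_var [::] i a -> False.
Proof.
by move=> v; refine (match v in has_var G _ _ return if G is [::] then False
  else True with var_last _ _ => I | var_skip _ _ _ _ _ => I end).
Qed.

(** Dependent case analysis in a nonempty context. The motive is quantified again inside the return
    clause, because its type depends on the context that the match generalizes. *)
Definition has_var_cons Γ φ (P : forall i a, has_var (φ :: Γ) i a -> Prop)
    (P0 : P 0 φ (var_last Γ φ))
    (PS : forall i a (v : has_var Γ i a), P i.+1 a (var_skip φ v))
    i a (v : has_var (φ :: Γ) i a) : P i a v :=
  match v in has_var G i a
    return match G return has_var G i a -> Prop with
           | φ :: Γ => fun v => forall P : (forall i a, has_var (φ :: Γ) i a -> Prop),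
               P 0 φ (var_last Γ φ) ->
               (forall i a (v : has_var Γ i a), P i.+1 a (var_skip φ v)) ->
               P i a v
           | [::] => fun _ => True
           end v
  with
  | var_last _ _ => fun P P0 PS => P0
  | var_skip _ _ _ _ v => fun P P0 PS => PS _ _ v
  end P P0 PS.

Lemma has_var_size Γ i a : has_var Γ i a -> i < size Γ.
Proof. by elim. Qed.

Arguments interp_ty : simpl never.

Section Soundness.

Variables (C : iel_category) (p : nat -> C).

Local Notation "'⟦' Γ '⟧'" := (interp_ctx p Γ).
Local Notation "'⦅' φ '⦆'" := (interp_ty p φ).
Local Notation "'⟦○' φs '⟧'" := (interp_ctx p (map Box φs)).
Local Notation F := (fmap iel_F).
Local Notation mul := (mon_mul_seq p).
Local Notation α φ := (iel_alpha (interp_ty p φ)).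

Fixpoint take_ctx (φs ψs : seq ty) : hom ⟦φs ++ ψs⟧ ⟦φs⟧ :=
  match φs with
  | [::] => bang _
  | φ :: φs => pairing (take_ctx φs ψs \oc pr1) pr2
  end.

Fixpoint drop_ctx (φs ψs : seq ty) : hom ⟦φs ++ ψs⟧ ⟦ψs⟧ :=
  match φs with
  | [::] => idm _
  | φ :: φs => drop_ctx φs ψs \oc pr1
  end.

Fixpoint cat_tuple (X : C) (φs ψs : seq ty) :
    hom X ⟦○φs⟧ -> hom X ⟦○ψs⟧ -> hom X ⟦○(φs ++ ψs)⟧ :=
  match φs with
  | [::] => fun _ gs => gs
  | φ :: φs => fun fs gs => pairing (cat_tuple (pr1 \oc fs) gs) (pr2 \oc fs)
  end.

Fixpoint pure_tuple (X : C) (φs : seq ty) : hom X ⟦φs⟧ -> hom X ⟦○φs⟧ :=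
  match φs with
  | [::] => fun _ => bang X
  | φ :: φs => fun fs =>
      pairing (pure_tuple (pr1 \oc fs)) (α φ \oc (pr2 \oc fs))
  end.

Lemma mul_cons (X : C) φ φs (fs : hom X ⟦○φs⟧) (f : hom X ⦅Box φ⦆) :
  mul (φ :: φs) \oc pairing fs f =
  mon_mul iel_F ⟦φs⟧ ⦅φ⦆ \oc pairing (mul φs \oc fs) f.
Proof. by rewrite /= -compA prod_map_pairing comp_idl. Qed.

(** By induction on [φs] from u = α_1 and m ∘ (α × α) = α. *)
Lemma mul_pure (X : C) φs (fs : hom X ⟦φs⟧) :
  mul φs \oc pure_tuple fs = iel_alpha _ \oc fs.
Proof.
elim: φs fs => [|φ φs IH] fs /=.
  by rewrite iel_unit; congr (_ \oc _); apply: bang_eq.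
by rewrite mul_cons IH mul_alpha -pairing_uniq.
Qed.

(** Induction on [φs], with [mul_unitr] for the empty list and [mul_assoc] for a cons. The part [ψs]
    is the left factor because lists store their last item at the head. *)
Lemma mul_cat (X : C) φs ψs (fs : hom X ⟦○φs⟧) (gs : hom X ⟦○ψs⟧) :
  F (pairing (drop_ctx φs ψs) (take_ctx φs ψs))
    \oc (mul (φs ++ ψs) \oc cat_tuple fs gs) =
  mon_mul iel_F _ _ \oc pairing (mul ψs \oc gs) (mul φs \oc fs).
Proof.
elim: φs fs => [|φ φs IH] fs /=; first by rewrite (bang_uniq fs) mul_unitr.
rewrite -/(mul (φ :: φs)) -/(mul (φ :: φs ++ ψs)) mul_cons.
rewrite {3}(pairing_uniq fs) mul_cons -mul_assoc -IH.
rewrite mul_natural_l.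
rewrite !compA -fmap_comp; congr (F _ \oc _ \oc _).
rewrite /prod_assoc /prod_map !pairing_comp -!compA !pr1_pairing !pr2_pairing.
by rewrite comp_idl.
Qed.

(** The transitions between worlds of the Kripke relation: a renaming of terms together with the
    arrow that interprets it. *)
Definition wk Δ Γ (ρ : nat -> nat) (r : hom ⟦Δ⟧ ⟦Γ⟧) : Prop :=
  forall i a (v : has_var Γ i a),
    exists v' : has_var Δ (ρ i) a, interp_var p v' = interp_var p v \oc r.

Lemma wk_id Γ : wk id (idm ⟦Γ⟧).
Proof. by move=> i a v; exists v; rewrite comp_idr. Qed.

Lemma wk_S Γ φ : wk S (pr1 : hom ⟦φ :: Γ⟧ ⟦Γ⟧).
Proof. by move=> i a v; exists (var_skip φ v). Qed.

Lemma wk_comp Θ Δ Γ ρ ρ' (r : hom ⟦Δ⟧ ⟦Γ⟧) (r' : hom ⟦Θ⟧ ⟦Δ⟧) :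
  wk ρ r -> wk ρ' r' -> wk (ρ' \o ρ) (r \oc r').
Proof.
move=> h h' i a v; have [v1 e1] := h i a v; have [v2 e2] := h' _ _ v1.
by exists v2; rewrite e2 e1 compA.
Qed.

Lemma wk_up Δ Γ φ ρ (r : hom ⟦Δ⟧ ⟦Γ⟧) :
  wk ρ r ->
  wk (up_ren ρ) (pairing (r \oc pr1) pr2 : hom ⟦φ :: Δ⟧ ⟦φ :: Γ⟧).
Proof.
move=> h i a v; elim/has_var_cons: v => [|{}i {}a v] /=.
  by exists (var_last Δ φ); rewrite pr2_pairing.
have [v' e] := h _ _ v; exists (var_skip φ v') => /=.
by rewrite e -!compA pr1_pairing.
Qed.

Lemma wk_nil Γ ρ (r : hom ⟦Γ⟧ ⟦[::]⟧) : wk ρ r.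
Proof. by move=> i a v; case: (has_var_nil v). Qed.

Lemma wk_take φs ψs : wk id (take_ctx φs ψs).
Proof.
elim: φs => [|φ φs IH] i a v; first by case: (has_var_nil v).
elim/has_var_cons: v => [|{}i {}a v] /=.
  by exists (var_last _ φ); rewrite pr2_pairing.
have [v' e] := IH _ _ v; exists (var_skip φ v') => /=.
by rewrite e -!compA pr1_pairing.
Qed.

Lemma wk_drop φs ψs : wk (addn (size φs)) (drop_ctx φs ψs).
Proof.
elim: φs => [|φ φs IH] /=; first exact: wk_id.
exact: wk_comp IH (@wk_S _ φ).
Qed.

(** * Denotations of typed terms *)

(** The graph of the interpretation: it forgets the derivation and keeps its arrow, so that subject
    reduction and preservation of the interpretation become the single statement [den_step]. *)
Inductive den : forall Γ, term -> forall φ, hom ⟦Γ⟧ ⦅φ⦆ -> Prop :=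
| den_Var Γ i φ (v : has_var Γ i φ) : den (Var i) (interp_var p v)
| den_Lam Γ M φ ψ (f : hom ⟦φ :: Γ⟧ ⦅ψ⦆) :
    @den (φ :: Γ) M ψ f -> @den Γ (Lam M) (Arr φ ψ) (curry f)
| den_App Γ M N φ ψ (f : hom ⟦Γ⟧ ⦅Arr φ ψ⦆) (g : hom ⟦Γ⟧ ⦅φ⦆) :
    den M f -> den N g -> @den Γ (App M N) ψ (ev \oc pairing f g)
| den_Pair Γ M N φ ψ (f : hom ⟦Γ⟧ ⦅φ⦆) (g : hom ⟦Γ⟧ ⦅ψ⦆) :
    den M f -> den N g -> @den Γ (Pair M N) (Prod φ ψ) (pairing f g)
| den_Fst Γ M φ ψ (f : hom ⟦Γ⟧ ⦅Prod φ ψ⦆) :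
    den M f -> @den Γ (Fst M) φ (pr1 \oc f)
| den_Snd Γ M φ ψ (f : hom ⟦Γ⟧ ⦅Prod φ ψ⦆) :
    den M f -> @den Γ (Snd M) ψ (pr2 \oc f)
| den_Pure Γ M φ (f : hom ⟦Γ⟧ ⦅φ⦆) :
    den M f -> @den Γ (Pure M) (Box φ) (α φ \oc f)
| den_Let Γ Ms φs N ψ (fs : hom ⟦Γ⟧ ⟦○φs⟧) (g : hom ⟦φs⟧ ⦅ψ⦆) :
    @dens Γ Ms φs fs -> den N g ->
    @den Γ (Let Ms N) (Box ψ) (F g \oc mul φs \oc fs)
with dens : forall Γ, seq term -> forall φs, hom ⟦Γ⟧ ⟦○φs⟧ -> Prop :=
| dens_nil Γ : @dens Γ [::] [::] (bang _)
| dens_cons Γ M Ms φ φs (f : hom ⟦Γ⟧ ⦅Box φ⦆) (fs : hom ⟦Γ⟧ ⟦○φs⟧) :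
    den M f -> dens Ms fs -> @dens Γ (M :: Ms) (φ :: φs) (pairing fs f).

Scheme den_mut := Minimality for den Sort Prop
with dens_mut := Minimality for dens Sort Prop.
Combined Scheme den_dens_ind from den_mut, dens_mut.

Scheme has_type_mut := Induction for has_type Sort Prop
with has_box_types_mut := Induction for has_box_types Sort Prop.

Lemma den_interp Γ M φ (D : has_type Γ M φ) : den M (interp p D).
Proof.
apply: (has_type_mut (P := fun Γ M φ D => den M (interp p D))
  (P0 := fun Γ Ms φs Ds => dens Ms (interp_seq p Ds))) => /= *;
  by econstructor; eauto.
Qed.

(** The dependent match on the term and the type avoids the equalities between dependent pairs that
    [inversion] would leave. *)
Lemma den_inv Γ M φ (f : hom ⟦Γ⟧ ⦅φ⦆) : den M f ->
  match M with
  | Var i => exists v : has_var Γ i φ, f = interp_var p v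
  | Lam M => match φ return hom ⟦Γ⟧ ⦅φ⦆ -> Prop with
    | Arr a b => fun f => exists2 g : hom ⟦a :: Γ⟧ ⦅b⦆, den M g & f = curry g
    | _ => fun _ => False
    end f
  | App M N => exists a (g : hom ⟦Γ⟧ ⦅Arr a φ⦆) (h : hom ⟦Γ⟧ ⦅a⦆),
      [/\ den M g, den N h & f = ev \oc pairing g h]
  | Pair M N => match φ return hom ⟦Γ⟧ ⦅φ⦆ -> Prop with
    | Prod a b => fun f => exists (g : hom ⟦Γ⟧ ⦅a⦆) (h : hom ⟦Γ⟧ ⦅b⦆),
        [/\ den M g, den N h & f = pairing g h]
    | _ => fun _ => False
    end f
  | Fst M => exists a (g : hom ⟦Γ⟧ ⦅Prod φ a⦆), den M g /\ f = pr1 \oc g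
  | Snd M => exists a (g : hom ⟦Γ⟧ ⦅Prod a φ⦆), den M g /\ f = pr2 \oc g
  | Pure M => match φ return hom ⟦Γ⟧ ⦅φ⦆ -> Prop with
    | Box a => fun f => exists2 g : hom ⟦Γ⟧ ⦅a⦆, den M g & f = α a \oc g
    | _ => fun _ => False
    end f
  | Let Ms N => match φ return hom ⟦Γ⟧ ⦅φ⦆ -> Prop with
    | Box a => fun f => exists φs (gs : hom ⟦Γ⟧ ⟦○φs⟧) (h : hom ⟦φs⟧ ⦅a⦆),
        [/\ dens Ms gs, den N h & f = F h \oc mul φs \oc gs]
    | _ => fun _ => False
    end f
  end.
Proof. by case=> *; repeat esplit; eauto. Qed.

Lemma dens_inv Γ Ms φs (fs : hom ⟦Γ⟧ ⟦○φs⟧) : dens Ms fs ->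
  match Ms, φs return hom ⟦Γ⟧ ⟦○φs⟧ -> Prop with
  | [::], [::] => fun _ => True
  | M :: Ms, φ :: φs => fun fs => exists (g : hom ⟦Γ⟧ ⦅Box φ⦆) gs,
      [/\ den M g, dens Ms gs & fs = pairing gs g]
  | _, _ => fun _ => False
  end fs.
Proof. by case=> *; repeat esplit; eauto. Qed.

Lemma dens_size Γ Ms φs (fs : hom ⟦Γ⟧ ⟦○φs⟧) : dens Ms fs -> size Ms = size φs.
Proof.
elim: Ms φs fs => [|M Ms IH] [|φ φs] fs /dens_inv //=.
by case=> [g [gs [_ /IH -> _]]].
Qed.

Lemma den_ren_mut :
  (forall Γ M φ (f : hom ⟦Γ⟧ ⦅φ⦆), den M f ->
    forall Δ ρ (r : hom ⟦Δ⟧ ⟦Γ⟧), wk ρ r -> den (ren ρ M) (f \oc r)) /\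
  (forall Γ Ms φs (fs : hom ⟦Γ⟧ ⟦○φs⟧), dens Ms fs ->
    forall Δ ρ (r : hom ⟦Δ⟧ ⟦Γ⟧), wk ρ r -> dens (map (ren ρ) Ms) (fs \oc r)).
Proof.
apply: den_dens_ind => [Γ i φ v|Γ M φ ψ f _ IH|Γ M N φ ψ f g _ IHM _ IHN|
    Γ M N φ ψ f g _ IHM _ IHN|Γ M φ ψ f _ IH|Γ M φ ψ f _ IH|Γ M φ f _ IH|
    Γ Ms φs N ψ fs g _ IH dN _|Γ|Γ M Ms φ φs f fs _ IHM _ IHMs] Δ ρ r h /=.
- by have [v' <-] := h _ _ v; constructor.
- by rewrite curry_comp; constructor; apply: IH (wk_up h).
- by rewrite -compA pairing_comp; econstructor; eauto.
- by rewrite pairing_comp; constructor; eauto.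
- by rewrite -compA; econstructor; eauto.
- by rewrite -compA; econstructor; eauto.
- by rewrite -compA; constructor; eauto.
- by rewrite -(compA _ fs); constructor; eauto.
- by rewrite (bang_uniq (bang _ \oc r)); constructor.
- by rewrite pairing_comp; constructor; eauto.
Qed.

Definition den_ren := den_ren_mut.1.

Definition den_env Δ Γ (s : nat -> term) (γ : hom ⟦Δ⟧ ⟦Γ⟧) : Prop :=
  forall i a (v : has_var Γ i a), den (s i) (interp_var p v \oc γ).

Lemma den_env_up Δ Γ φ s (γ : hom ⟦Δ⟧ ⟦Γ⟧) : den_env s γ ->
  den_env (up_subst s) (pairing (γ \oc pr1) pr2 : hom ⟦φ :: Δ⟧ ⟦φ :: Γ⟧).
Proof.
move=> h i a v; elim/has_var_cons: v => [|{}i {}a v] /=.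
  by rewrite pr2_pairing; apply: (den_Var (var_last Δ φ)).
rewrite -compA pr1_pairing compA; apply: den_ren (h _ _ v) _ _ _ _.
exact: wk_S.
Qed.

Lemma den_subst_mut :
  (forall Γ M φ (f : hom ⟦Γ⟧ ⦅φ⦆), den M f ->
    forall Δ s (γ : hom ⟦Δ⟧ ⟦Γ⟧), den_env s γ -> den (subst s M) (f \oc γ)) /\
  (forall Γ Ms φs (fs : hom ⟦Γ⟧ ⟦○φs⟧), dens Ms fs ->
    forall Δ s (γ : hom ⟦Δ⟧ ⟦Γ⟧), den_env s γ ->
      dens (map (subst s) Ms) (fs \oc γ)).
Proof.
apply: den_dens_ind => [Γ i φ v|Γ M φ ψ f _ IH|Γ M N φ ψ f g _ IHM _ IHN|
    Γ M N φ ψ f g _ IHM _ IHN|Γ M φ ψ f _ IH|Γ M φ ψ f _ IH|Γ M φ f _ IH|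
    Γ Ms φs N ψ fs g _ IH dN _|Γ|Γ M Ms φ φs f fs _ IHM _ IHMs] Δ s γ h /=.
- exact: h.
- by rewrite curry_comp; constructor; apply: IH (den_env_up h).
- by rewrite -compA pairing_comp; econstructor; eauto.
- by rewrite pairing_comp; constructor; eauto.
- by rewrite -compA; econstructor; eauto.
- by rewrite -compA; econstructor; eauto.
- by rewrite -compA; constructor; eauto.
- by rewrite -(compA _ fs); constructor; eauto.
- by rewrite (bang_uniq (bang _ \oc γ)); constructor.
- by rewrite pairing_comp; constructor; eauto.
Qed.

Definition den_subst := den_subst_mut.1.

(** * Subject reduction *)

Lemma dens_cat Γ Ms Ns φs ψs (fs : hom ⟦Γ⟧ ⟦○φs⟧) (gs : hom ⟦Γ⟧ ⟦○ψs⟧) :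
  dens Ms fs -> dens Ns gs -> dens (Ms ++ Ns) (cat_tuple fs gs).
Proof.
move=> dMs dNs; elim: Ms φs fs dMs => [|M Ms IH] [|φ φs] fs /dens_inv //=.
case=> f [fs' [dM /IH dMs ->]].
by rewrite pr1_pairing pr2_pairing; constructor.
Qed.

(** The default [d] of [nth] is arbitrary because typed variables stay in range; the induction uses
    the tail with [d] shifted by one. *)
Lemma dens_map_Pure Γ Ms φs (fs : hom ⟦Γ⟧ ⟦○φs⟧) : dens (map Pure Ms) fs ->
  exists2 gs : hom ⟦Γ⟧ ⟦φs⟧, fs = pure_tuple gs &
    forall d, den_env (fun i => nth (d i) Ms i) gs.
Proof.
elim: Ms φs fs => [|M Ms IH] [|φ φs] fs // dMs; have := dens_inv dMs => //=.
  move=> _; exists (bang _); first exact: bang_eq.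
  by move=> d i a v; case: (has_var_nil v).
case=> f [fs' [dM /IH [gs -> hgs] ->]].
case: (den_inv dM) => g dg ->.
exists (pairing gs g); first by rewrite /= pr1_pairing pr2_pairing.
move=> d i a v; elim/has_var_cons: v => [|{}i {}a v] /=.
  by rewrite pr2_pairing.
by rewrite -compA pr1_pairing; apply: (hgs (d \o S)).
Qed.

(* The arrow θ interprets the simultaneous substitution performed by
   [subst_at]. *)
Lemma dens_flatten Γ Ms Ns Ps Q φs (fs : hom ⟦Γ⟧ ⟦○φs⟧) :
  dens (Ps ++ Let Ns Q :: Ms) fs ->
  exists ψs (gs : hom ⟦Γ⟧ ⟦○ψs⟧) (θ : hom ⟦ψs⟧ ⟦φs⟧),
    [/\ dens (Ps ++ Ns ++ Ms) gs,
        F θ \oc (mul ψs \oc gs) = mul φs \oc fs &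
        den_env (fun i => if i < size Ps then Var i
                  else if i == size Ps then ren (addn (size Ps)) Q
                  else Var (i.-1 + size Ns)) θ].
Proof.
elim: Ps φs fs => [|P Ps IH] [|φ φs] fs dfs; have := dens_inv dfs => //= {dfs}.
- case=> f [fs' [dL dMs ->]].
  have [χs [gs [g [dNs dQ ->]]]] := den_inv dL.
  (* The variables [χs] of the inner let replace its slot: Q is evaluated on them to recover that
     slot, and [φs] is passed on. *)
  exists (χs ++ φs), (cat_tuple gs fs').
  exists (pairing (drop_ctx χs φs) (g \oc take_ctx χs φs)); split.
  + exact: dens_cat.
  + rewrite -/(mul (φ :: φs)) mul_cons -!compA mul_natural_r -mul_cat.
    rewrite [RHS]compA -fmap_comp.
    by rewrite prod_map_pairing comp_idl.
  + move=> i a v; elim/has_var_cons: v => [|{}i {}a v] /=.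
      rewrite pr2_pairing; apply: den_ren dQ _ _ _ _.
      exact: wk_take.
    rewrite -compA pr1_pairing addnC (dens_size dNs).
    by have [v' <-] := wk_drop χs v; constructor.
- case=> f [fs' [dP /IH [ψs [gs [θ [dgs e hθ]]]] ->]].
  exists (φ :: ψs), (pairing gs f), (pairing (θ \oc pr1) pr2); split.
  + by constructor.
  + rewrite -/(mul (φ :: φs)) -/(mul (φ :: ψs)) !mul_cons -e mul_natural_l.
    by rewrite /prod_map comp_idl.
  + move=> i a v; elim/has_var_cons: v => [|{}i {}a v] /=.
      by rewrite pr2_pairing; apply: (den_Var (var_last ψs φ)).
    rewrite -compA pr1_pairing compA.
    have := den_ren (hθ _ _ v) (@wk_S ψs φ); rewrite ltnS eqSS.
    case: ltngtP => // lt_i.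
      (* Here [i] lies beyond the replaced slot, hence is positive, and [i.-1.+1] is [i]. *)
      by rewrite /= -addSn prednK // (leq_ltn_trans _ lt_i).
    by rewrite ren_ren.
Qed.

Lemma dens_step_at Γ Ps M M' Ms φs (fs : hom ⟦Γ⟧ ⟦○φs⟧) :
  (forall φ (f : hom ⟦Γ⟧ ⦅φ⦆), den M f -> den M' f) ->
  dens (Ps ++ M :: Ms) fs -> dens (Ps ++ M' :: Ms) fs.
Proof.
move=> MM'; elim: Ps φs fs => [|P Ps IH] [|φ φs] fs /dens_inv //=;
  by case=> f [fs' [d1 d2 ->]]; constructor; eauto.
Qed.

(** The three rules for let rest, in order, on [dens_flatten], on [mul_pure] with the naturality of
    α, and on u = α_1. *)
Lemma den_step M M' : step M M' ->
  forall Γ φ (f : hom ⟦Γ⟧ ⦅φ⦆), den M f -> den M' f.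
Proof.
elim=> {M M'} [M N|M N|M N|Ms Ns Ps Q R|Ms N|M|M M' _ IH|M M' N _ IH|
    M N N' _ IH|M M' N _ IH|M N N' _ IH|M M' _ IH|M M' _ IH|M M' _ IH|
    Ps M M' Ms N _ IH|Ms N N' _ IH] Γ φ f /den_inv.
- case=> a [g [h [/den_inv [g' dM ->] dN ->]]].
  rewrite -[curry g']comp_idr ev_curry_pairing subst_seq1.
  apply: den_subst dM _ _ _ _ => i b v.
  elim/has_var_cons: v => [|{}i {}b v] /=; first by rewrite pr2_pairing.
  by rewrite -compA pr1_pairing comp_idr; constructor.
- by case=> a [g [/den_inv [h [k [dM dN ->]]] ->]]; rewrite pr1_pairing.
- by case=> a [g [/den_inv [h [k [dM dN ->]]] ->]]; rewrite pr2_pairing.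
- case: φ f => // φ f [φs [fs [g [dfs dR ->]]]].
  have [ψs [gs [θ [dgs e hθ]]]] := dens_flatten dfs.
  rewrite -compA -e compA -fmap_comp compA; constructor=> //.
  exact: den_subst dR _ _ _ hθ.
- case: φ f => // φ f [φs [fs [g [/dens_map_Pure [gs -> hgs] dN ->]]]].
  rewrite -compA mul_pure alpha_natural; constructor.
  exact: den_subst dN _ _ _ (hgs _).
- case: φ f => // φ f [φs [fs [g [dfs dM ->]]]].
  case: φs fs g dfs dM => [|φ' φs] fs g /dens_inv // _ dM.
  rewrite /= iel_unit -compA alpha_natural; constructor.
  (* The body is typed in the empty context, so the identity renaming weakens it to [Γ]. *)
  by rewrite -(ren_id (r := id) M) //; apply: den_ren dM _ _ _ (wk_nil _ _).
- by case: φ f => // a b f [g dM ->]; constructor; apply: IH.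
- by case=> a [g [h [dM dN ->]]]; econstructor; eauto.
- by case=> a [g [h [dM dN ->]]]; econstructor; eauto.
- by case: φ f => // a b f [g [h [dM dN ->]]]; econstructor; eauto.
- by case: φ f => // a b f [g [h [dM dN ->]]]; econstructor; eauto.
- by case=> a [g [dM ->]]; econstructor; eauto.
- by case=> a [g [dM ->]]; econstructor; eauto.
- by case: φ f => // a f [g dM ->]; constructor; apply: IH.
- case: φ f => // a f [φs [gs [h [dMs dN ->]]]]; constructor => //.
  exact: dens_step_at (IH Γ) dMs.
- by case: φ f => // a f [φs [gs [h [dMs dN ->]]]]; constructor; eauto.
Qed.

Lemma den_multistep M M' : multistep M M' ->
  forall Γ φ (f : hom ⟦Γ⟧ ⦅φ⦆), den M f -> den M' f.
Proof.
elim=> {M M'} [M M'|M|M N P _ IH1 _ IH2] Γ φ f dM //; first exact: den_step dM.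
by apply: IH2; apply: IH1.
Qed.


(** * Normal forms *)

Definition ty_eq_dec (φ ψ : ty) : {φ = ψ} + {φ <> ψ}.
Proof. by decide equality; apply: eq_comparable. Defined.

(** Packing the target type allows arrows to be compared before their types are known to agree;
    decidable equality of types then gives [arrow_inj] without axioms. *)
Definition arrow Γ : Type := {φ : ty & hom ⟦Γ⟧ ⦅φ⦆}.

Definition tuple_arrow Γ : Type := {φs : seq ty & hom ⟦Γ⟧ ⟦○φs⟧}.

Lemma arrow_inj Γ φ (f g : hom ⟦Γ⟧ ⦅φ⦆) :
  existT _ φ f = existT _ φ g :> arrow Γ -> f = g.
Proof. exact: Eqdep_dec.inj_pair2_eq_dec ty_eq_dec _ _ _ _. Qed.

Lemma tuple_arrow_inj Γ φs (f g : hom ⟦Γ⟧ ⟦○φs⟧) :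
  existT _ φs f = existT _ φs g :> tuple_arrow Γ -> f = g.
Proof.
apply: Eqdep_dec.inj_pair2_eq_dec => x y.
by decide equality; apply: ty_eq_dec.
Qed.

(** Computes the projection from [Γ] and [i] alone, which makes it independent of the [has_var]
    derivation. *)
Fixpoint var_arrow Γ i : option (arrow Γ) :=
  match Γ, i with
  | [::], _ => None
  | φ :: Γ, 0 => Some (existT (fun ψ => hom ⟦φ :: Γ⟧ ⦅ψ⦆) φ pr2)
  | φ :: Γ, i.+1 =>
      if var_arrow Γ i is Some (existT a f)
      then Some (existT (fun ψ => hom ⟦φ :: Γ⟧ ⦅ψ⦆) a (f \oc pr1)) else None
  end.

Lemma interp_var_arrow Γ i φ (v : has_var Γ i φ) :
  var_arrow Γ i = Some (existT _ φ (interp_var p v)).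
Proof. by elim: v => //= {}Γ ψ {}i {}φ v ->. Qed.

Lemma interp_var_det Γ i φ ψ (v : has_var Γ i φ) (w : has_var Γ i ψ) :
  existT _ φ (interp_var p v) = existT _ ψ (interp_var p w) :> arrow Γ.
Proof. by have := interp_var_arrow v; rewrite (interp_var_arrow w) => -[]. Qed.

(* The argument of a neutral application is required to have normal forms under
   all renamings, which makes [ne] stable under renaming although [down] is
   not. *)
Inductive ne : forall Γ, term -> forall φ, hom ⟦Γ⟧ ⦅φ⦆ -> Prop :=
| ne_Var Γ i φ (v : has_var Γ i φ) : ne (Var i) (interp_var p v)
| ne_App Γ K N φ ψ (f : hom ⟦Γ⟧ ⦅Arr φ ψ⦆) (g : hom ⟦Γ⟧ ⦅φ⦆) :
    ne K f ->
    (forall Δ ρ (r : hom ⟦Δ⟧ ⟦Γ⟧), wk ρ r -> nf (ren ρ N) (g \oc r)) ->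
    @ne Γ (App K N) ψ (ev \oc pairing f g)
| ne_Fst Γ K φ ψ (f : hom ⟦Γ⟧ ⦅Prod φ ψ⦆) :
    ne K f -> @ne Γ (Fst K) φ (pr1 \oc f)
| ne_Snd Γ K φ ψ (f : hom ⟦Γ⟧ ⦅Prod φ ψ⦆) :
    ne K f -> @ne Γ (Snd K) ψ (pr2 \oc f)
with nf : forall Γ, term -> forall φ, hom ⟦Γ⟧ ⦅φ⦆ -> Prop :=
| nf_Atom Γ M K i (f : hom ⟦Γ⟧ ⦅Atom i⦆) :
    down (size Γ) M [:: K] (Var 0) -> ne K f -> nf M f
| nf_Arr Γ M φ ψ (f : hom ⟦φ :: Γ⟧ ⦅ψ⦆) :
    @nf (φ :: Γ) (App (ren S M) (Var 0)) ψ f -> @nf Γ M (Arr φ ψ) (curry f)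
| nf_Prod Γ M φ ψ (f : hom ⟦Γ⟧ ⦅φ⦆) (g : hom ⟦Γ⟧ ⦅ψ⦆) :
    nf (Fst M) f -> nf (Snd M) g -> @nf Γ M (Prod φ ψ) (pairing f g)
| nf_Box Γ M Ks N φs ψ (ks : hom ⟦Γ⟧ ⟦○φs⟧) (g : hom ⟦φs⟧ ⦅ψ⦆) :
    down (size Γ) M Ks N -> slots Ks ks -> nf N g ->
    @nf Γ M (Box ψ) (F g \oc (mul φs \oc ks))
with slots : forall Γ, seq term -> forall φs, hom ⟦Γ⟧ ⟦○φs⟧ -> Prop :=
| slots_nil Γ : @slots Γ [::] [::] (bang _)
| slots_Pure Γ i Ks φ φs (v : has_var Γ i φ) (ks : hom ⟦Γ⟧ ⟦○φs⟧) :
    slots Ks ks ->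
    @slots Γ (Pure (Var i) :: Ks) (φ :: φs)
      (pairing ks (α φ \oc interp_var p v))
| slots_ne Γ K Ks φ φs (k : hom ⟦Γ⟧ ⦅Box φ⦆) (ks : hom ⟦Γ⟧ ⟦○φs⟧) :
    ne K k -> slots Ks ks -> @slots Γ (K :: Ks) (φ :: φs) (pairing ks k).

Scheme ne_mut := Minimality for ne Sort Prop
with nf_mut := Minimality for nf Sort Prop
with slots_mut := Minimality for slots Sort Prop.
Combined Scheme ne_nf_slots_ind from ne_mut, nf_mut, slots_mut.

Lemma ne_inv Γ K φ (f : hom ⟦Γ⟧ ⦅φ⦆) : ne K f ->
  match K with
  | Var i => exists v : has_var Γ i φ, f = interp_var p v
  | App K N => exists a (g : hom ⟦Γ⟧ ⦅Arr a φ⦆) (h : hom ⟦Γ⟧ ⦅a⦆),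
      [/\ ne K g, nf N h & f = ev \oc pairing g h]
  | Fst K => exists a (g : hom ⟦Γ⟧ ⦅Prod φ a⦆), ne K g /\ f = pr1 \oc g
  | Snd K => exists a (g : hom ⟦Γ⟧ ⦅Prod a φ⦆), ne K g /\ f = pr2 \oc g
  | _ => False
  end.
Proof.
case=> {Γ K φ f} [Γ i φ v|Γ K N φ ψ f g nK nN|Γ K φ ψ f nK|Γ K φ ψ f nK];
  try by repeat esplit; eauto.
exists φ, f, g; split=> //.
by have := nN _ _ _ (@wk_id Γ); rewrite ren_id // comp_idr.
Qed.

Lemma nf_inv Γ M φ (f : hom ⟦Γ⟧ ⦅φ⦆) : nf M f ->
  match φ return hom ⟦Γ⟧ ⦅φ⦆ -> Prop with
  | Atom i => fun f => exists2 K, down (size Γ) M [:: K] (Var 0) & ne K f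
  | Arr a b => fun f => exists2 g : hom ⟦a :: Γ⟧ ⦅b⦆,
      nf (App (ren S M) (Var 0)) g & f = curry g
  | Prod a b => fun f => exists (g : hom ⟦Γ⟧ ⦅a⦆) (h : hom ⟦Γ⟧ ⦅b⦆),
      [/\ nf (Fst M) g, nf (Snd M) h & f = pairing g h]
  | Box a => fun f => exists Ks N φs (ks : hom ⟦Γ⟧ ⟦○φs⟧) (g : hom ⟦φs⟧ ⦅a⦆),
      [/\ down (size Γ) M Ks N, slots Ks ks, nf N g &
          f = F g \oc (mul φs \oc ks)]
  end f.
Proof. by case=> *; repeat esplit; eauto. Qed.

Lemma slots_inv Γ Ks φs (fs : hom ⟦Γ⟧ ⟦○φs⟧) : slots Ks fs ->
  match Ks, φs return hom ⟦Γ⟧ ⟦○φs⟧ -> Prop with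
  | [::], [::] => fun fs => fs = bang _
  | K :: Ks, φ :: φs => fun fs => exists (k : hom ⟦Γ⟧ ⦅Box φ⦆) ks,
      [/\ ne K k \/ (exists i (v : has_var Γ i φ),
             K = Pure (Var i) /\ k = α φ \oc interp_var p v),
          slots Ks ks & fs = pairing ks k]
  | _, _ => fun _ => False
  end fs.
Proof. by case=> *; repeat esplit; eauto 7. Qed.

(** As in bidirectional typing, [ne] and [slots] synthesize their types, starting from the types of
    variables, while [nf] is checked against a given type. The evaluation steps inside [nf] are
    unique by [down_det]. *)
Lemma ne_nf_slots_det :
  [/\ forall Γ K φ (f : hom ⟦Γ⟧ ⦅φ⦆), ne K f ->
      forall ψ (g : hom ⟦Γ⟧ ⦅ψ⦆), ne K g ->
        existT _ φ f = existT _ ψ g :> arrow Γ,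
    forall Γ M φ (f : hom ⟦Γ⟧ ⦅φ⦆), nf M f -> forall g, nf M g -> f = g &
    forall Γ Ks φs (f : hom ⟦Γ⟧ ⟦○φs⟧), slots Ks f ->
      forall ψs (g : hom ⟦Γ⟧ ⟦○ψs⟧), slots Ks g ->
        existT _ φs f = existT _ ψs g :> tuple_arrow Γ].
Proof.
suff: (forall Γ K φ (f : hom ⟦Γ⟧ ⦅φ⦆), ne K f ->
      forall ψ (g : hom ⟦Γ⟧ ⦅ψ⦆), ne K g ->
        existT _ φ f = existT _ ψ g :> arrow Γ) /\
    (forall Γ M φ (f : hom ⟦Γ⟧ ⦅φ⦆), nf M f -> forall g, nf M g -> f = g) /\
    (forall Γ Ks φs (f : hom ⟦Γ⟧ ⟦○φs⟧), slots Ks f ->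
      forall ψs (g : hom ⟦Γ⟧ ⟦○ψs⟧), slots Ks g ->
        existT _ φs f = existT _ ψs g :> tuple_arrow Γ).
  by case=> ? [].
apply: ne_nf_slots_ind => [Γ i φ v|Γ K N φ ψ f g _ IHK _ IHN|
    Γ K φ ψ f _ IH|Γ K φ ψ f _ IH|Γ M K i f dM _ IH|Γ M φ ψ f _ IH|
    Γ M φ ψ f g _ IHf _ IHg|Γ M Ks N φs ψ ks g dM _ IHKs _ IHN|Γ|
    Γ i Ks φ φs v ks _ IH|Γ K Ks φ φs k ks nK IHK _ IHKs].
- by move=> ψ g /ne_inv [w ->]; apply: interp_var_det.
- move=> χ e /ne_inv [a [f' [g' [/IHK E nN ->]]]].
  (* The type of the head fixes the type of the argument, so that [IHN] applies. *)
  case: (E) => ea eχ _; move: f' g' nN E; rewrite -ea -eχ => f' g' nN.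
  have := IHN _ _ _ (@wk_id Γ); rewrite ren_id // comp_idr => /(_ _ nN) ->.
  by move/arrow_inj => ->.
- move=> χ e /ne_inv [a [g [/IH E ->]]].
  by case: (E) => ea eχ _; move: g E; rewrite -ea -eχ => g /arrow_inj ->.
- move=> χ e /ne_inv [a [g [/IH E ->]]].
  by case: (E) => ea eχ _; move: g E; rewrite -ea -eχ => g /arrow_inj ->.
- move=> g /nf_inv [L dL]; case: (down_det dM dL) => -[<-] _ nL.
  exact: arrow_inj (IH _ _ nL).
- by move=> g /nf_inv [h /IH -> ->].
- by move=> e /nf_inv [f' [g' [/IHf -> /IHg -> ->]]].
- move=> e /nf_inv [Ls [N' [φs' [ks' [g' [dM' sL nN ->]]]]]].
  have [eK eN] := down_det dM dM'; subst Ls N'.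
  (* Equal slots have equal types, which puts both bodies in the same context before [IHN] compares
     them. *)
  have E := IHKs _ _ sL; case: (E) => eφ _; move: ks' g' nN E {sL}.
  by rewrite -eφ => ks' g' /IHN -> /tuple_arrow_inj ->.
- by case=> [|ψ ψs] g /slots_inv //= ->.
- case=> [|ψ ψs] g /slots_inv // [l [ls [[/ne_inv//|]]]].
  case=> [j [w [[e] ->]]] /IH E ->; subst j; have E' := interp_var_det v w.
  case: (E) (E') => eφs _ [eφ _]; move: w ls E E'; rewrite -eφ -eφs => w ls.
  by move=> /tuple_arrow_inj -> /arrow_inj ->.
- case=> [|ψ ψs] g /slots_inv // [l [ls [[/IHK E|]]]]; last first.
    by case=> [i [w [eK]]]; move: nK; rewrite eK => /ne_inv.
  move=> /IHKs E' ->.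
  case: (E') (E) => eφs _ [eφ _]; move: l ls E E'; rewrite -eφ -eφs => l ls.
  by move=> /arrow_inj -> /tuple_arrow_inj ->.
Qed.

Lemma ne_neutral Γ K φ (f : hom ⟦Γ⟧ ⦅φ⦆) : ne K f -> neutral K.
Proof.
elim: K φ f => [i|M IH|K IH N _|M _ N _|K IH|K IH|M _|Ms N _] φ f /ne_inv //.
- by case=> [a [g [h [/IH]]]].
- by case=> [a [g [/IH]]].
- by case=> [a [g [/IH]]].
Qed.

Lemma ne_ren Δ Γ K φ (f : hom ⟦Γ⟧ ⦅φ⦆) ρ (r : hom ⟦Δ⟧ ⟦Γ⟧) :
  ne K f -> wk ρ r -> ne (ren ρ K) (f \oc r).
Proof.
move=> nK; move: Δ ρ r.
apply: (ne_mut (P := fun Γ K φ f => forall Δ ρ (r : hom ⟦Δ⟧ ⟦Γ⟧), wk ρ r ->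
    ne (ren ρ K) (f \oc r)) (P0 := fun _ _ _ _ => True)
    (P1 := fun _ _ _ _ => True)) nK => //= {Γ K φ f}
    [Γ i φ v|Γ K N φ ψ f g _ IHK nN _|Γ K φ ψ f _ IH|Γ K φ ψ f _ IH] Δ ρ r h.
- by have [v' <-] := h _ _ v; constructor.
- rewrite -compA pairing_comp; apply: ne_App; first exact: IHK.
  by move=> Θ ρ' r' h'; rewrite ren_ren -compA; apply: nN (wk_comp h h').
- by rewrite -compA; econstructor; eauto.
- by rewrite -compA; econstructor; eauto.
Qed.

(** * Normalization *)

(** At a modal type the body is reducible in the context of its slots, which is not an extension of
    the current one. Renamings are quantified even at atomic and modal types because [down] is not
    stable under them: [down_Pure] lists the whole context. *)
Fixpoint red φ : forall Γ, term -> hom ⟦Γ⟧ ⦅φ⦆ -> Prop :=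
  match φ return forall Γ, term -> hom ⟦Γ⟧ ⦅φ⦆ -> Prop with
  | Atom i => fun Γ M f => forall Δ ρ (r : hom ⟦Δ⟧ ⟦Γ⟧), wk ρ r ->
      @nf Δ (ren ρ M) (Atom i) (f \oc r)
  | Arr a b => fun Γ M f => forall Δ ρ (r : hom ⟦Δ⟧ ⟦Γ⟧), wk ρ r ->
      forall N (g : hom ⟦Δ⟧ ⦅a⦆), @red a Δ N g ->
        @red b Δ (App (ren ρ M) N) (ev \oc pairing (f \oc r) g)
  | Prod a b => fun Γ M f =>
      @red a Γ (Fst M) (pr1 \oc f) /\ @red b Γ (Snd M) (pr2 \oc f)
  | Box a => fun Γ M f => forall Δ ρ (r : hom ⟦Δ⟧ ⟦Γ⟧), wk ρ r ->
      exists Ks N φs (ks : hom ⟦Δ⟧ ⟦○φs⟧) (g : hom ⟦φs⟧ ⦅a⦆),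
        [/\ down (size Δ) (ren ρ M) Ks N, slots Ks ks, @red a φs N g &
            f \oc r = F g \oc (mul φs \oc ks)]
  end.

Arguments red {φ Γ} M f.

Lemma red_ren φ Δ Γ M (f : hom ⟦Γ⟧ ⦅φ⦆) ρ (r : hom ⟦Δ⟧ ⟦Γ⟧) :
  red M f -> wk ρ r -> red (ren ρ M) (f \oc r).
Proof.
elim: φ M f => [i|a _ b _|a IHa b IHb|a _] M f /= rM h.
- by move=> Θ ρ' r' h'; rewrite ren_ren -compA; apply: rM (wk_comp h h').
- move=> Θ ρ' r' h' N g rN.
  by rewrite ren_ren -compA; apply: rM (wk_comp h h') _ _ rN.
- by rewrite !compA; split; [apply: (IHa (Fst M))|apply: (IHb (Snd M))];
    case: rM.
- by move=> Θ ρ' r' h'; rewrite ren_ren -compA; apply: rM (wk_comp h h').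
Qed.

(** At arrow and product types the step moves into the head of an elimination; at atomic and modal
    types it becomes a [down_wh]. *)
Lemma red_wh φ Γ M M' (f : hom ⟦Γ⟧ ⦅φ⦆) : wh M M' -> red M' f -> red M f.
Proof.
elim: φ Γ M M' f => [i|a _ b IHb|a IHa b IHb|a _] Γ M M' f MM' /= rM'.
- move=> Δ ρ r h; have /nf_inv [K dK nK] := rM' _ _ _ h.
  by apply: nf_Atom nK; apply: down_wh dK; apply: wh_ren.
- move=> Δ ρ r h N g rN.
  by apply: IHb (rM' _ _ _ h _ _ rN); constructor; apply: wh_ren.
- case: rM' => r1 r2; split.
    by apply: IHa r1; constructor.
  by apply: IHb r2; constructor.
- move=> Δ ρ r h; have [Ks [N [φs [ks [g [dM' sK rN e]]]]]] := rM' _ _ _ h.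
  exists Ks, N, φs, ks, g; split=> //.
  by apply: down_wh dM'; apply: wh_ren.
Qed.

Lemma reflect_reify φ :
  (forall Γ K (f : hom ⟦Γ⟧ ⦅φ⦆), ne K f -> red K f) /\
  (forall Γ M (f : hom ⟦Γ⟧ ⦅φ⦆), red M f -> nf M f).
Proof.
elim: φ => [i|a [IHa IHa'] b [IHb IHb']|a [IHa IHa'] b [IHb IHb']|a [IHa IHa']].
- split=> Γ M f /=.
    move=> nM Δ ρ r h; apply: nf_Atom (ne_ren nM h).
    by apply: down_neutral; rewrite neutral_ren; apply: ne_neutral nM.
  by move/(_ _ _ _ (@wk_id Γ)); rewrite ren_id // comp_idr.
- split=> Γ M f /=.
    move=> nM Δ ρ r h N g rN; apply: IHb; apply: ne_App (ne_ren nM h) _.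
    by move=> Θ ρ' r' h'; apply: IHa'; apply: red_ren.
  (* Eta expansion: the fresh variable is neutral, hence reducible by reflection. *)
  move=> /(_ _ _ _ (@wk_S Γ a) (Var 0) pr2) rM.
  rewrite (curry_uniq f); apply: nf_Arr; apply: IHb'; apply: rM.
  exact: IHa (ne_Var (var_last Γ a)).
- split=> Γ M f /=.
    by move=> nM; split; [apply: IHa|apply: IHb]; econstructor; eauto.
  case=> r1 r2; rewrite (pairing_uniq f).
  by apply: nf_Prod; [apply: IHa'|apply: IHb'].
- split=> Γ M f /=; last first.
    move=> /(_ _ _ _ (@wk_id Γ)); rewrite ren_id // comp_idr.
    by case=> [Ks [N [φs [ks [g [dM sK /IHa' nN ->]]]]]]; apply: nf_Box dM sK nN.
  (* A neutral K of modal type is read as let x = K in x; the equation is the left unit law. *)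
  move=> nM Δ ρ r h; exists [:: ren ρ M], (Var 0), [:: a].
  exists (pairing (bang _) (f \oc r)), pr2; split.
  + by apply: down_neutral; rewrite neutral_ren; apply: ne_neutral nM.
  + apply: slots_ne (ne_ren nM h) _; exact: slots_nil.
  + exact: IHa (ne_Var (var_last [::] a)).
  + by rewrite (@mul_cons ⟦Δ⟧ a [::]) mul_unitl.
Qed.

Definition red_env Δ Γ (s : nat -> term) (γ : hom ⟦Δ⟧ ⟦Γ⟧) : Prop :=
  forall i a (v : has_var Γ i a), red (s i) (interp_var p v \oc γ).

Lemma red_env_ren Θ Δ Γ s (γ : hom ⟦Δ⟧ ⟦Γ⟧) ρ (r : hom ⟦Θ⟧ ⟦Δ⟧) :
  red_env s γ -> wk ρ r -> red_env (ren ρ \o s) (γ \oc r).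
Proof. by move=> rs h i a v; rewrite compA; apply: red_ren h; apply: rs. Qed.

Lemma red_env_cons Δ Γ φ M s (f : hom ⟦Δ⟧ ⦅φ⦆) (γ : hom ⟦Δ⟧ ⟦Γ⟧) :
  red M f -> red_env s γ ->
  red_env (scons M s) (pairing γ f : hom ⟦Δ⟧ ⟦φ :: Γ⟧).
Proof.
move=> rM rs i a v; elim/has_var_cons: v => [|{}i {}a v] /=.
  by rewrite pr2_pairing.
by rewrite -compA pr1_pairing; apply: rs.
Qed.

Lemma slots_cat Γ Ks Ls φs ψs (ks : hom ⟦Γ⟧ ⟦○φs⟧) (ls : hom ⟦Γ⟧ ⟦○ψs⟧) :
  slots Ks ks -> slots Ls ls -> slots (Ks ++ Ls) (cat_tuple ks ls).
Proof.
move=> sK sL; elim: Ks φs ks sK => [|K Ks IH] [|φ φs] ks /slots_inv //=.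
case=> k [ks' [nK /IH {}IH ->]]; rewrite pr1_pairing pr2_pairing.
case: nK => [nK|[i [v [-> ->]]]]; first exact: slots_ne.
exact: slots_Pure.
Qed.

Lemma slots_size Γ Ks φs (ks : hom ⟦Γ⟧ ⟦○φs⟧) :
  slots Ks ks -> size Ks = size φs.
Proof.
elim: Ks φs ks => [|K Ks IH] [|φ φs] ks /slots_inv //=.
by case=> [k [ks' [_ /IH -> _]]].
Qed.

(** The offset [k] is for the induction, where the tail of [φs] starts at index [k.+1]; the use is
    at [k = 0] and the identity. *)
Lemma slots_pure Γ φs k (r : hom ⟦Γ⟧ ⟦φs⟧) : wk (addn k) r ->
  slots [seq Pure (Var i) | i <- iota k (size φs)] (pure_tuple r).
Proof.
elim: φs k r => [|φ φs IH] k r h /=; first exact: slots_nil.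
have [v e] := h _ _ (var_last φs φ); rewrite addn0 in v e; rewrite -e.
apply: slots_Pure; apply: IH => i a w.
have [w' e'] := h _ _ (var_skip φ w); rewrite addnS -addSn in w' e'.
by exists w'; rewrite e' /= compA.
Qed.

(** Fundamental lemma. For the items of a let, the slots are concatenated, and the bodies of the
    items, moved to this joint context, form a reducible environment for the body of the let. *)
Lemma red_mut :
  (forall Γ M φ (f : hom ⟦Γ⟧ ⦅φ⦆), den M f ->
    forall Δ s (γ : hom ⟦Δ⟧ ⟦Γ⟧), red_env s γ -> red (subst s M) (f \oc γ)) /\
  (forall Γ Ms φs (fs : hom ⟦Γ⟧ ⟦○φs⟧), dens Ms fs ->
    forall Δ s (γ : hom ⟦Δ⟧ ⟦Γ⟧), red_env s γ ->
      exists Ks Ns ψs (ks : hom ⟦Δ⟧ ⟦○ψs⟧) (g : hom ⟦ψs⟧ ⟦φs⟧),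
        [/\ downs (size Δ) (map (subst s) Ms) Ks Ns, slots Ks ks,
            size Ns = size φs, red_env (fun i => nth (Var i) Ns i) g &
            mul φs \oc (fs \oc γ) = F g \oc (mul ψs \oc ks)]).
Proof.
apply: den_dens_ind => [Γ i φ v|Γ M φ ψ f _ IH|Γ M N φ ψ f g _ IHM _ IHN|
    Γ M N φ ψ f g _ IHM _ IHN|Γ M φ ψ f _ IH|Γ M φ ψ f _ IH|Γ M φ f _ IH|
    Γ Ms φs N ψ fs g _ IH dN IHN|Γ|Γ M Ms φ φs f fs _ IHM _ IHMs] Δ s γ rs.
- exact: rs.
- move=> Θ ρ r h N g rN /=.
  apply: red_wh; first exact: wh_beta.
  rewrite subst_seq1 ren_subst -compA ev_curry_pairing subst_subst.
  have := IH _ _ _ (red_env_cons rN (red_env_ren rs h)).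
  rewrite -subst_scons_up subst_subst (_ : subst _ M = subst
    (subst (scons N Var) \o (ren (up_ren ρ) \o up_subst s)) M) //.
  by apply: subst_ext => -[|i] //=; rewrite !ren_ren.
- have /= := IHM _ _ _ rs _ _ _ (@wk_id Δ) _ _ (IHN _ _ _ rs).
  by rewrite ren_id // comp_idr -compA pairing_comp.
- rewrite pairing_comp /= pr1_pairing pr2_pairing; split.
    by apply: red_wh (IHM _ _ _ rs); constructor.
  by apply: red_wh (IHN _ _ _ rs); constructor.
- by rewrite -compA; case: (IH _ _ _ rs).
- by rewrite -compA; case: (IH _ _ _ rs).
- move=> Θ ρ r h /=.
  (* The context [Θ] is bound to itself as in [down_Pure]; the equation follows from [mul_pure] and
     the naturality of α. *)
  exists [seq Pure (Var i) | i <- iota 0 (size Θ)], (ren ρ (subst s M)), Θ.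
  exists (pure_tuple (idm _)), (f \oc γ \oc r); split.
  + exact: down_Pure.
  + by apply: slots_pure; apply: wk_id.
  + by apply: red_ren h; apply: IH.
  + by rewrite mul_pure alpha_natural comp_idr !compA.
- move=> Θ ρ r h.
  have [Ks [Ns [ψs [ks [g' [dMs sK _ rNs e]]]]]] := IH _ _ _ (red_env_ren rs h).
  exists Ks, (subst (fun i => nth (Var i) Ns i) N), ψs, ks, (g \oc g'); split=> //.
  + rewrite /= -map_comp; apply: down_Let.
    by rewrite (eq_map (g := subst (ren ρ \o s))) // => M /=; rewrite ren_subst.
  + exact: IHN rNs.
  + by rewrite -!compA e fmap_comp -!compA.
- exists [::], [::], [::], (bang _), (idm _); split.
  + exact: downs_nil.
  + exact: slots_nil.
  + by [].
  + by move=> i a v; case: (has_var_nil v).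
  + rewrite fmap_id comp_idl; congr (_ \oc _); exact: bang_eq.
- have [Ks [N [φs0 [ks [g]]]]] := IHM _ _ _ rs _ _ _ (@wk_id Δ).
  rewrite ren_id // comp_idr => -[dM sK rN e].
  have [Ls [Ns [ψs [ls [gs [dMs sL szN rNs es]]]]]] := IHMs _ _ _ rs.
  exists (Ks ++ Ls), (N :: map (ren (addn (size Ks))) Ns), (φs0 ++ ψs).
  exists (cat_tuple ks ls).
  (* The joint context is split into the slots of M, on which [g] acts, and those of the remaining
     items, on which [gs] acts. *)
  exists (prod_map gs g \oc pairing (drop_ctx φs0 ψs) (take_ctx φs0 ψs)); split.
  + exact: downs_cons.
  + exact: slots_cat.
  + by rewrite /= size_map szN.
  + move=> i a v; elim/has_var_cons: v => [|{}i {}a v] /=.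
      rewrite compA /prod_map pr2_pairing -compA pr2_pairing.
      rewrite -(ren_id (r := id) N) //; apply: red_ren rN _; exact: wk_take.
    rewrite -compA prod_map_pairing pr1_pairing compA.
    (* The index is in range by [szN], so the default may change from [Var i.+1] to [Var i]. *)
    rewrite (nth_map (Var i)) ?szN ?(has_var_size v) //.
    by apply: red_ren (rNs _ _ v) _; rewrite (slots_size sK); apply: wk_drop.
  + rewrite pairing_comp -/(mul (φ :: φs)) mul_cons e es mul_natural.
    by rewrite fmap_comp -[RHS]compA mul_cat.
Qed.

(** The fundamental lemma at the identity substitution, whose variables are reducible by reflection,
    followed by reification. *)
Lemma den_nf Γ M φ (f : hom ⟦Γ⟧ ⦅φ⦆) : den M f -> nf M f.
Proof.
move=> dM; apply: (reflect_reify φ).2; rewrite -(subst_Var (s := Var) M) //.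
rewrite -[f]comp_idr; apply: red_mut.1 dM _ _ _ _ => i a v.
rewrite comp_idr; exact: (reflect_reify a).1 (ne_Var v).
Qed.

Lemma den_det Γ M φ (f g : hom ⟦Γ⟧ ⦅φ⦆) : den M f -> den M g -> f = g.
Proof.
have [_ det _] := ne_nf_slots_det.
by move=> /den_nf nf_f /den_nf; apply: det.
Qed.

End Soundness.

Theorem theorem5 (C : iel_category) (p : nat -> C)
    (Γ : seq ty) (M N : term) (φ : ty)
    (D : has_type Γ M φ) (E : has_type Γ N φ) :
  conv M N -> interp p D = interp p E.
Proof.
have dM := den_interp p D; have dN := den_interp p E.
case=> /den_multistep; first by move=> /(_ _ _ _ _ _ dM) /den_det; apply.
by move=> /(_ _ _ _ _ _ dN) dM'; apply: den_det dM dM'.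
Qed.
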